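(* Let $M\subseteq\mathbb R^4$ be a connected open set with coordinates $(x,r,x^3,x^4)$, let $h=h(x,x^3,x^4)$ and $f=f(x^3,x^4)$ be nowhere vanishing smooth functions on $M$, and let $g$ be the generalized pp-wave metric $$ds^2=-2h\,(dx)^2+2\,dx\,dr-\tfrac12 f\,[(dx^3)^2+(dx^4)^2].$$ Suppose the cosmological constant $\Lambda$ is zero. Then $g$ is a pure radiation metric if and only if it is a pp-wave metric.
   Context: The energy-momentum tensor is $T=\frac{c^4}{8\pi G}\left[S-\left(\frac{\kappa}{2}-\Lambda\right)g\right]$, where $S$ is the Ricci tensor, $\kappa$ the scalar curvature, and $c,G>0$ constants (speed of light, gravitational constant). The metric is a pure radiation metric if $T=\rho\,\xi\otimes\xi$ for some function $\rho$ (possibly zero) and some nowhere vanishing null 1-form $\xi$. A Brinkmann-wave is a Lorentzian manifold admitting a nonzero parallel null vector field; it is called a pp-wave if its curvature tensor satisfies ${R_{ij}}^{pq}R_{pqkl}=0$ (indices raised with $g$). *)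

(* Defs.v *)
From HB Require Import structures.
From mathcomp Require Import all_boot all_order all_algebra.
From mathcomp Require Import all_classical all_reals all_analysis.

Set Implicit Arguments.
Unset Strict Implicit.
Unset Printing Implicit Defensive.

Import Order.TTheory GRing.Theory Num.Theory.
Import numFieldNormedType.Exports.

Local Open Scope classical_set_scope.
Local Open Scope ring_scope.

Section Smooth.
Variables (R : realType) (n : nat).
Implicit Types (M : set 'rV[R]_n) (F : 'rV[R]_n -> R).

Definition partial (i : 'I_n) F : 'rV[R]_n -> R :=
  fun p => 'D_(delta_mx 0 i) F p.

(* Functions are total; for M open only the values on M matter. *)
Fixpoint Ck_on (k : nat) M F : Prop :=
  (forall p, M p -> {for p, continuous F}) /\
  match k with
  | 0 => True
  | k'.+1 => forall i : 'I_n,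
      (forall p, M p -> derivable F p (delta_mx 0 i)) /\
      Ck_on k' M (partial i F)
  end.

Definition smooth_on M F : Prop := forall k, Ck_on k M F.

Definition smooth_field_on M (X : 'rV[R]_n -> 'rV[R]_n) : Prop :=
  forall i, smooth_on M (fun p => X p 0 i).

End Smooth.

(* A metric on an open subset of R^n is the matrix field of its components
   g_ij in the standard coordinates; a vector field V, resp. a 1-form xi, is
   the row of its components V^i, resp. xi_i. *)
Section Curvature.
Variables (R : realType) (n : nat) (g : 'rV[R]_n -> 'M[R]_n).
Implicit Types (i j k l a b m : 'I_n) (p : 'rV[R]_n).

Definition ginv p : 'M[R]_n := invmx (g p).

(* Gamma^i_jk *)
Definition christoffel i j k p : R :=
  2^-1 * \sum_l ginv p i l *
    (partial j (fun q => g q l k) p + partial k (fun q => g q l j) p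
     - partial l (fun q => g q j k) p).

(* R^i_jkl; the sign is such that the Ricci tensor of a round sphere is
   positive. *)
Definition riemann_up i j k l p : R :=
  partial k (christoffel i l j) p - partial l (christoffel i k j) p
  + \sum_m (christoffel i k m p * christoffel m l j p
            - christoffel i l m p * christoffel m k j p).

(* R_ijkl *)
Definition riemann i j k l p : R := \sum_m g p i m * riemann_up m j k l p.

(* R_ij^kl *)
Definition riemann_mixed i j k l p : R :=
  \sum_a \sum_b ginv p k a * ginv p l b * riemann i j a b p.

Definition ricci i j p : R := \sum_k riemann_up k i k j p.

Definition scalar_curvature p : R := \sum_i \sum_j ginv p i j * ricci i j p.

Definition energy_momentum (c G Lambda : R) i j p : R :=
  c ^+ 4 / (8 * pi * G) *
    (ricci i j p - (scalar_curvature p / 2 - Lambda) * g p i j).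

(* nabla_j V^i *)
Definition covariant_deriv (V : 'rV[R]_n -> 'rV[R]_n) j i p : R :=
  partial j (fun q => V q 0 i) p + \sum_k christoffel i j k p * V p 0 k.

Definition null_vector p (v : 'rV[R]_n) : Prop :=
  \sum_i \sum_j g p i j * v 0 i * v 0 j = 0.

Definition null_covector p (xi : 'rV[R]_n) : Prop :=
  \sum_i \sum_j ginv p i j * xi 0 i * xi 0 j = 0.

End Curvature.

Section Spacetimes.
Variables (R : realType) (n : nat).
Variables (M : set 'rV[R]_n) (g : 'rV[R]_n -> 'M[R]_n).

(* diag(-1, 1, ..., 1) *)
Definition minkowski_mx : 'M[R]_n :=
  \matrix_(i, j) if i == j then (if val i == 0%N then -1 else 1) else 0.

(* Both sign conventions (-,+,...,+) and (+,-,...,-) are admitted; the choice is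
   uniform over M. *)
Definition lorentzian : Prop :=
  [/\ forall i j, smooth_on M (fun p => g p i j),
      forall p, M p -> (g p)^T = g p
    & exists2 s : R, s = 1 \/ s = -1 &
      forall p, M p -> exists2 P : 'M[R]_n,
        P \in unitmx & P *m g p *m P^T = s *: minkowski_mx].

Definition brinkmann_wave : Prop :=
  lorentzian /\
  exists V : 'rV[R]_n -> 'rV[R]_n,
    [/\ smooth_field_on M V,
        forall p, M p -> V p != 0,
        forall p, M p -> null_vector g p (V p)
      & forall p, M p -> forall i j, covariant_deriv g V j i p = 0].

Definition pp_wave : Prop :=
  brinkmann_wave /\
  forall p, M p -> forall i j k l,
    \sum_a \sum_b riemann_mixed g i j a b p * riemann g a b k l p = 0.

Definition pure_radiation (c G Lambda : R) : Prop :=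
  exists (rho : 'rV[R]_n -> R) (xi : 'rV[R]_n -> 'rV[R]_n),
    [/\ smooth_on M rho,
        smooth_field_on M xi,
        forall p, M p -> xi p != 0,
        forall p, M p -> null_covector g p (xi p)
      & forall p, M p -> forall i j,
          energy_momentum g c G Lambda i j p = rho p * xi p 0 i * xi p 0 j].

End Spacetimes.

(* The coordinates (x, r, x^3, x^4) of p : 'rV[R]_4 are
   (p 0 0, p 0 1, p 0 2, p 0 3). *)
Section GeneralizedPPWave.
Variables (R : realType) (h : R -> R -> R -> R) (f : R -> R -> R).

Definition h_on_R4 (p : 'rV[R]_4) : R := h (p 0 0) (p 0 2) (p 0 3).

Definition f_on_R4 (p : 'rV[R]_4) : R := f (p 0 2) (p 0 3).

Definition gen_pp_metric (p : 'rV[R]_4) : 'M[R]_4 :=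
  \matrix_(i < 4, j < 4)
    match val i, val j with
    | 0%N, 0%N => - 2 * h_on_R4 p
    | 0%N, 1%N | 1%N, 0%N => 1
    | 2%N, 2%N | 3%N, 3%N => - 2^-1 * f_on_R4 p
    | _, _ => 0
    end.

End GeneralizedPPWave.

(* Main.v *)
Require Import Defs.
From mathcomp Require Import all_boot all_order all_algebra.
From mathcomp Require Import all_classical all_reals all_analysis.
From mathcomp Require Import ring.

(** Write H = - 2 h and F = - f / 2, so that the metric is
    H dx^2 + 2 dx dr + F ((dx^3)^2 + (dx^4)^2), where H and F do not depend on r
    and F does not depend on x. Both conditions turn out to be equivalent to
    the flatness of the transverse surface with the metric
    F ((dx^3)^2 + (dx^4)^2).

    Since the metric does not depend on r and its components g_rj are constant,
    no Christoffel symbol has a lower index r or an upper index x; so d_r is a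
    parallel null field and the curvature vanishes as soon as r occurs among the
    lower indices. What remains is the curvature of the transverse surface,
    with the single component K F = gauss_density, and the components with an x
    in both index pairs, which carry the second derivatives of H. The metric is
    always a Brinkmann wave: the only global point is that the sign of F is
    constant on the connected set M, so that the signature convention is uniform
    (constant_sign).

    The contraction of the curvature with itself, at the transverse indices, is
    2 (K F)^2 (pp_sum_34), so a pp-wave has K = 0; and if K = 0 every summand
    of the contraction vanishes, an x being raised to the null direction in one
    factor or missing from the other (pp_curvatureP).

    The Ricci tensor is K F on the transverse diagonal, plus a term along dx dx
    (ricciE); its off-diagonal transverse part vanishes by the symmetry of the
    second derivatives of F (half_dlog_closed, from mixed_derivatives_commute).
    Hence the scalar curvature is 2 K. Taking the trace of T = rho xi xi with xi
    null gives K = 0; conversely K = 0 leaves only the dx dx term, where dx is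
    null and parallel, and its coefficient is a smooth rho
    (pure_radiationP). *)

Set Implicit Arguments.
Unset Strict Implicit.
Unset Printing Implicit Defensive.

Import Order.TTheory GRing.Theory Num.Theory.
Import numFieldNormedType.Exports.

Local Open Scope classical_set_scope.
Local Open Scope ring_scope.

(** * Symmetry of mixed partial derivatives *)

Lemma dist_le_of_common_value (R : realFieldType) (a b x y e : R) :
  x = y -> `|a - x| < e / 2 -> `|b - y| < e / 2 -> `|a - b| <= e.
Proof.
move=> -> ax bx; rewrite (_ : a - b = (a - y) - (b - y)); last by ring.
by rewrite (le_trans (ler_normB _ _))// [leRHS]splitr lerD// ltW.
Qed.

Section MixedPartials.
Variables (R : realType) (V : normedModType R).
Implicit Types (F : V -> R) (p u v w : V).

Lemma is_derive_line F p v (s : R) :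
  derivable F (s *: v + p) v ->
  is_derive s 1 (fun t => F (t *: v + p)) ('D_v F (s *: v + p)).
Proof.
have E : (fun h => h^-1 *: (((fun t => F (t *: v + p)) \o shift s) (h *: 1)
            - F (s *: v + p))) =
         (fun h => h^-1 *: ((F \o shift (s *: v + p)) (h *: v)
            - F (s *: v + p))).
  by apply/funext => h /=; rewrite [h *: 1]mulr1 scalerDl addrA.
move=> dF; split; first by rewrite /derivable E.
by rewrite /derive E.
Qed.

Lemma mean_value_line F p v (t : R) : 0 < t ->
  (forall s, 0 <= s <= t -> derivable F (s *: v + p) v) ->
  exists2 s, 0 <= s <= t &
    F (t *: v + p) - F p = 'D_v F (s *: v + p) * t.
Proof.
move=> t0 dF; pose phi s := F (s *: v + p).
have dphi s : 0 <= s <= t -> is_derive s 1 phi ('D_v F (s *: v + p)).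
  by move=> /dF; exact: is_derive_line.
have [||s] := @MVT_segment R phi (fun s => 'D_v F (s *: v + p)) 0 t (ltW t0).
- move=> s; rewrite in_itv /= => /andP[/ltW s0 /ltW st].
  by apply: dphi; rewrite s0.
- apply: derivable_within_continuous => s; rewrite in_itv /= => st.
  by case: (dphi s st).
- rewrite in_itv /= => st; rewrite /phi scale0r add0r subr0 => E.
  by exists s.
Qed.

(** One mean value in the direction u, applied to the increment of F along
    t *: v, and then one in the direction v. Exchanging u and v leaves the left
    hand side unchanged, which is what makes the mixed derivatives commute. *)
Lemma second_difference F (A : set V) p u v (t : R) : 0 < t ->
  (forall s r, 0 <= s <= t -> 0 <= r <= t -> A (s *: u + (r *: v + p))) ->
  (forall q, A q -> derivable F q u) ->
  (forall q, A q -> derivable ('D_u F) q v) ->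
  exists2 q, A q &
    F (t *: u + (t *: v + p)) - F (t *: u + p) - F (t *: v + p) + F p
      = 'D_v ('D_u F) q * t * t.
Proof.
move=> t0 At du dvu.
have tt : 0 <= t <= t by rewrite lexx ltW.
have z : 0 <= (0 : R) <= t by rewrite lexx ltW.
have A0 s : 0 <= s <= t -> A (s *: u + p).
  by move=> st; have := At s 0 st z; rewrite scale0r add0r.
pose phi s := F (s *: u + (t *: v + p)) - F (s *: u + p).
have dphi s : 0 <= s <= t -> is_derive s 1 phi
    ('D_u F (s *: u + (t *: v + p)) - 'D_u F (s *: u + p)).
  move=> st; apply: is_deriveB; apply: is_derive_line; apply: du.
    exact: At.
  exact: A0.
have [||s] := @MVT_segment R phi
  (fun s => 'D_u F (s *: u + (t *: v + p)) - 'D_u F (s *: u + p)) 0 t (ltW t0).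
- move=> s; rewrite in_itv /= => /andP[/ltW s0 /ltW st].
  by apply: dphi; rewrite s0.
- apply: derivable_within_continuous => s; rewrite in_itv /= => st.
  by case: (dphi s st).
rewrite in_itv /= => st; rewrite /phi !scale0r !add0r subr0 => E.
have [r rt E2] := @mean_value_line ('D_u F) (s *: u + p) v t t0
  (fun r rt => dvu _ (eq_ind _ A (At s r st rt) _ (addrCA _ _ _))).
exists (r *: v + (s *: u + p)); first by rewrite addrCA; exact: At.
by rewrite -E2 (addrCA (t *: v) (s *: u)) -E; ring.
Qed.

(** On every small parallelogram at p the same second difference is t ^ 2 times
    a value of each of the two mixed derivatives, so both derivatives share
    values arbitrarily close to p; continuity at p identifies them there. *)
Lemma mixed_derivatives_commute F (A : set V) p u v : nbhs p A ->
  (forall q, A q -> derivable F q u) ->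
  (forall q, A q -> derivable F q v) ->
  (forall q, A q -> derivable ('D_u F) q v) ->
  (forall q, A q -> derivable ('D_v F) q u) ->
  {for p, continuous ('D_v ('D_u F))} ->
  {for p, continuous ('D_u ('D_v F))} ->
  'D_v ('D_u F) p = 'D_u ('D_v F) p.
Proof.
move=> pA du dv dvu duv cvu cuv.
apply/eqP; rewrite -subr_eq0 -normr_le0; apply/ler_addgt0Pr => e e0.
rewrite add0r.
have e2 : 0 < e / 2 by rewrite divr_gt0.
have := cvu; move/cvgrPdist_lt => /(_ _ e2) n1.
have := cuv; move/cvgrPdist_lt => /(_ _ e2) n2.
have [d /= d0 dA] : exists2 d : R, 0 < d & forall q, `|p - q| < d ->
   [/\ A q, `|'D_v ('D_u F) p - 'D_v ('D_u F) q| < e / 2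
     & `|'D_u ('D_v F) p - 'D_u ('D_v F) q| < e / 2].
  have pB : nbhs p (A `&`
      ([set q | `|'D_v ('D_u F) p - 'D_v ('D_u F) q| < e / 2] `&`
       [set q | `|'D_u ('D_v F) p - 'D_u ('D_v F) q| < e / 2])).
    exact: filterI pA (filterI n1 n2).
  have [d /= d0 H] := (nbhs_ballP _ _).1 pB.
  exists d => // q pq.
  have Bq : ball p d q.
    rewrite -ball_normE.
    exact: pq.
  have [Aq [h1 h2]] := H q Bq.
  exact: (And3 Aq h1 h2).
pose N := 1 + `|u| + `|v|.
have N0 : 0 < N by rewrite /N -addrA ltr_pwDl// addr_ge0.
(* with this t the whole parallelogram lies within d of p *)
pose t := d / 2 / N.
have t0 : 0 < t by rewrite !divr_gt0.
have near_p s r : 0 <= s <= t -> 0 <= r <= t ->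
    `|p - (s *: u + (r *: v + p))| < d.
  move=> /andP[s0 st] /andP[r0 rt].
  rewrite addrA opprD addrCA subrr addr0 normrN.
  apply: (le_lt_trans (ler_normD _ _)); rewrite !normrZ !ger0_norm//.
  apply: (@le_lt_trans _ _ (t * N)).
    apply: (@le_trans _ _ (t * `|u| + t * `|v|)).
      by rewrite lerD// ler_wpM2r.
    by rewrite /N -addrA mulrDr mulr1 -mulrDr lerDr ltW.
  by rewrite /t divfK ?gt_eqF// ltr_pdivrMr// ltr_pMr// ltr1n.
pose B := [set q | `|p - q| < d].
have [x Bx Ex] := @second_difference F B p u v t t0 near_p
  (fun q Bq => du q (let: And3 a _ _ := dA q Bq in a))
  (fun q Bq => dvu q (let: And3 a _ _ := dA q Bq in a)).
have near_p' s r : 0 <= s <= t -> 0 <= r <= t -> B (s *: v + (r *: u + p)).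
  by move=> st rt; rewrite addrCA; exact: near_p.
have [y By Ey] := @second_difference F B p v u t t0 near_p'
  (fun q Bq => dv q (let: And3 a _ _ := dA q Bq in a))
  (fun q Bq => duv q (let: And3 a _ _ := dA q Bq in a)).
have xy : 'D_v ('D_u F) x = 'D_u ('D_v F) y.
  apply: (mulIf (lt0r_neq0 t0)); apply: (mulIf (lt0r_neq0 t0)).
  apply: (etrans (esym Ex)); apply: (etrans _ Ey).
  rewrite (addrCA (t *: v) (t *: u)); congr (_ + _).
  exact: addrAC.
have [_ Hx _] := dA x Bx; have [_ _ Hy] := dA y By.
exact: (dist_le_of_common_value xy Hx Hy).
Qed.

End MixedPartials.

(** * Smooth functions on an open set *)

Section SmoothFunctions.
Variables (R : realType) (n : nat) (M : set 'rV[R]_n).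
Hypothesis M_open : open M.
Implicit Types (F G : 'rV[R]_n -> R) (i j : 'I_n) (k : nat).

Lemma near_eq_open F G p : (forall q, M q -> F q = G q) -> M p ->
  \near p, F p = G p.
Proof.
move=> FG Mp; have /filterS := open_nbhs_nbhs (conj M_open Mp).
by apply => q; exact: FG.
Qed.

Lemma eq_continuous_at F G p : (forall q, M q -> F q = G q) -> M p ->
  {for p, continuous F} -> {for p, continuous G}.
Proof.
move=> FG Mp cF; have H : G @ p --> F p.
  apply: cvg_trans cF; apply: (@near_eq_cvg _ _ (nbhs p) _ F G).
  exact: near_eq_open.
by move: H; rewrite (FG p Mp).
Qed.

Lemma eq_partial F G i p : (forall q, M q -> F q = G q) -> M p ->
  partial i F p = partial i G p.
Proof. by move=> FG Mp; apply: near_eq_derive; exact: near_eq_open. Qed.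

Lemma eq_Ck_on k F G : (forall p, M p -> F p = G p) ->
  Ck_on k M F -> Ck_on k M G.
Proof.
elim: k F G => [|k IH] F G FG [cF dF]; split=> //.
- by move=> p Mp; exact: eq_continuous_at (cF p Mp).
- by move=> p Mp; exact: eq_continuous_at (cF p Mp).
- move=> i; have [dFi CF] := dF i; split.
    move=> p Mp; apply: near_eq_derivable (dFi p Mp).
    exact: near_eq_open.
  by apply: IH CF => p Mp; exact: eq_partial.
Qed.

Lemma Ck_onW k F : Ck_on k.+1 M F -> Ck_on k M F.
Proof.
elim: k F => [|k IH] F [cF dF]; split=> // i.
by have [dFi CF] := dF i; split=> //; exact: IH.
Qed.

Lemma Ck_on_cst k (c : R) : Ck_on k M (fun=> c).
Proof.
elim: k c => [|k IH] c; split=> //;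
  try by move=> p _; exact: (@cst_continuous _ _ c p).
move=> i; split=> [p _|]; first exact: derivable_cst.
apply: (@eq_Ck_on _ (fun=> 0)) (IH 0) => p _.
by rewrite /partial derive_cst.
Qed.

Lemma Ck_onD k F G : Ck_on k M F -> Ck_on k M G ->
  Ck_on k M (fun p => F p + G p).
Proof.
elim: k F G => [|k IH] F G [cF dF] [cG dG]; split=> //;
  try by move=> p Mp; exact: cvgD (cF p Mp) (cG p Mp).
move=> i; have [dFi CF] := dF i; have [dGi CG] := dG i.
split=> [p Mp|]; first by apply: derivableD; [exact: dFi|exact: dGi].
apply: eq_Ck_on (IH _ _ CF CG) => p Mp.
by rewrite /partial deriveD//; [exact: dFi|exact: dGi].
Qed.

Lemma partialM F G i p :
  derivable F p (delta_mx 0 i) -> derivable G p (delta_mx 0 i) ->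
  partial i (fun q => F q * G q) p = F p * partial i G p + G p * partial i F p.
Proof. by move=> dF dG; rewrite /partial deriveM. Qed.

Lemma Ck_onM k F G : Ck_on k M F -> Ck_on k M G ->
  Ck_on k M (fun p => F p * G p).
Proof.
elim: k F G => [|k IH] F G CkF CkG; have [cF dF] := CkF; have [cG dG] := CkG;
  split=> //; try by move=> p Mp; exact: cvgM (cF p Mp) (cG p Mp).
move=> i; have [dFi CF] := dF i; have [dGi CG] := dG i.
split=> [p Mp|]; first by apply: derivableM; [exact: dFi|exact: dGi].
have CkF' := Ck_onW CkF; have CkG' := Ck_onW CkG.
apply: eq_Ck_on (Ck_onD (IH _ _ CkF' CG) (IH _ _ CkG' CF)) => p Mp.
by rewrite partialM//; [exact: dFi|exact: dGi].
Qed.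

Lemma partialV F i p : F p != 0 -> derivable F p (delta_mx 0 i) ->
  partial i (fun q => (F q)^-1) p = - 1 * ((F p)^-1 * (F p)^-1 * partial i F p).
Proof.
by move=> F0 dF; rewrite /partial deriveV// scaleNr mulN1r -exprVn expr2.
Qed.

(** No composition rule is needed: the derivative of 1 / F is - F' / F ^ 2,
    a product of functions of class C^k by induction on k. *)
Lemma Ck_onV k F : (forall p, M p -> F p != 0) -> Ck_on k M F ->
  Ck_on k M (fun p => (F p)^-1).
Proof.
move=> F0; elim: k => [|k IH] CkF; have [cF dF] := CkF;
  split=> //; try by move=> p Mp; exact: cvgV (F0 p Mp) (cF p Mp).
move=> i; have [dFi CF] := dF i.
split=> [p Mp|]; first by apply: derivableV; [exact: F0|exact: dFi].
have CV := IH (Ck_onW CkF).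
apply: eq_Ck_on (Ck_onM (Ck_on_cst k (-1)) (Ck_onM (Ck_onM CV CV) CF)) => p Mp.
by rewrite partialV//; [exact: F0|exact: dFi].
Qed.

Lemma smooth_continuous F p : smooth_on M F -> M p -> {for p, continuous F}.
Proof. by move=> /(_ 0%N) [cF _] Mp; exact: cF. Qed.

Lemma smooth_derivable F i p : smooth_on M F -> M p ->
  derivable F p (delta_mx 0 i).
Proof. by move=> /(_ 1%N) [_ /(_ i) [dF _]] Mp; exact: dF. Qed.

Lemma smooth_partial F i : smooth_on M F -> smooth_on M (partial i F).
Proof. by move=> sF k; have [_ /(_ i) []] := sF k.+1. Qed.

Lemma eq_smooth F G : (forall p, M p -> F p = G p) ->
  smooth_on M F -> smooth_on M G.
Proof. by move=> FG sF k; exact: eq_Ck_on (sF k). Qed.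

Lemma smooth_cst (c : R) : smooth_on M (fun=> c).
Proof. by move=> k; exact: Ck_on_cst. Qed.

Lemma smoothD F G : smooth_on M F -> smooth_on M G ->
  smooth_on M (fun p => F p + G p).
Proof. by move=> sF sG k; exact: Ck_onD. Qed.

Lemma smoothM F G : smooth_on M F -> smooth_on M G ->
  smooth_on M (fun p => F p * G p).
Proof. by move=> sF sG k; exact: Ck_onM. Qed.

Lemma smoothV F : (forall p, M p -> F p != 0) -> smooth_on M F ->
  smooth_on M (fun p => (F p)^-1).
Proof. by move=> F0 sF k; exact: Ck_onV. Qed.

Lemma partialC F i j p : smooth_on M F -> M p ->
  partial i (partial j F) p = partial j (partial i F) p.
Proof.
move=> sF Mp; apply: (@mixed_derivatives_commute _ _ _ M).
- exact: open_nbhs_nbhs.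
- by move=> q; exact: smooth_derivable.
- by move=> q; exact: smooth_derivable.
- by move=> q; apply: smooth_derivable; exact: smooth_partial.
- by move=> q; apply: smooth_derivable; exact: smooth_partial.
- by apply: smooth_continuous Mp; do 2 apply: smooth_partial.
- by apply: smooth_continuous Mp; do 2 apply: smooth_partial.
Qed.

End SmoothFunctions.

Lemma partial_cst (R : realType) n (i : 'I_n) (c : R) p :
  partial i (fun=> c) p = 0.
Proof. by rewrite /partial derive_cst. Qed.

Lemma partialN (R : realType) n (i : 'I_n) (F : 'rV[R]_n -> R) p :
  derivable F p (delta_mx 0 i) ->
  partial i (fun q => - F q) p = - partial i F p.
Proof. by move=> dF; rewrite /partial deriveN. Qed.

(** Translation invariance is a condition on the whole of R^n, so it passes to
    the partial derivatives without any differentiability. *)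
Definition invariant_along (R : realType) n (i : 'I_n) (T : Type)
    (F : 'rV[R]_n -> T) :=
  forall t p, F (t *: delta_mx 0 i + p) = F p.

Lemma partial_invariant (R : realType) n (i j : 'I_n) (F : 'rV[R]_n -> R) :
  invariant_along i F -> invariant_along i (partial j F).
Proof.
move=> Fi t p; rewrite /partial /derive.
set u := (X in lim (X @ _)); set v := (X in _ = lim (X @ _)).
suff -> : u = v by [].
apply/funext => s; rewrite /u /v /= Fi; congr (_ *: (_ - _)).
by rewrite addrCA Fi.
Qed.

Lemma partial_along_invariant (R : realType) n (i : 'I_n)
    (F : 'rV[R]_n -> R) p :
  invariant_along i F -> partial i F p = 0.
Proof.
move=> Fi; rewrite /partial /derive.
set u := (X in lim (X @ _)).
have -> : u = fun=> 0 by apply/funext => s; rewrite /u /= Fi subrr scaler0.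
exact: lim_cst.
Qed.

(** * The wave metric *)

(** The indices of the coordinates x, r, x^3, x^4. An index a is transverse,
    that is i3 or i4, exactly when 1 < a. *)
Notation ix := (@Ordinal 4 0 isT).
Notation ir := (@Ordinal 4 1 isT).
Notation i3 := (@Ordinal 4 2 isT).
Notation i4 := (@Ordinal 4 3 isT).

Lemma ord4_ind (P : 'I_4 -> Prop) :
  P ix -> P ir -> P i3 -> P i4 -> forall i, P i.
Proof.
by move=> P0 P1 P2 P3 [[|[|[|[|//]]]] lti]; rewrite (bool_irrelevance lti isT).
Qed.

Lemma sum4 (V : nmodType) (E : 'I_4 -> V) :
  \sum_i E i = E ix + E ir + E i3 + E i4.
Proof.
rewrite !big_ord_recl big_ord0 addr0 !addrA.
by congr (_ + E _ + E _ + E _); [congr E|..]; apply: val_inj.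
Qed.

(** The generalized pp-wave metric with the coefficients H = - 2 h and
    F = - f / 2, so that no numerical factor enters the computations. *)
Definition wave_metric (R : realType) (H F : 'rV[R]_4 -> R) (p : 'rV[R]_4) :
    'M[R]_4 :=
  \matrix_(i < 4, j < 4)
    match val i, val j with
    | 0%N, 0%N => H p
    | 0%N, 1%N | 1%N, 0%N => 1
    | 2%N, 2%N | 3%N, 3%N => F p
    | _, _ => 0
    end.

Local Opaque partial.

Lemma sum_transverse (V : nmodType) (E : 'I_4 -> 'I_4 -> V) :
  (forall a b : 'I_4, ~~ ((1 < a)%N && (1 < b)%N) -> E a b = 0) ->
  \sum_a \sum_b E a b = E i3 i3 + E i3 i4 + (E i4 i3 + E i4 i4).
Proof.
move=> E0; rewrite sum4 !sum4 !(E0 ix)// !(E0 ir)// !(E0 _ ix)// !(E0 _ ir)//.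
by rewrite !addr0 !add0r.
Qed.

(** The first two rows are the combinations d_x + b d_r of square - s and s:
    the square of such a vector is h + 2 b. The last two are normalized when
    r ^ 2 is the inverse of |F|. *)
Definition orthonormal_frame (R : realFieldType) (h r s : R) : 'M[R]_4 :=
  \matrix_(i < 4, j < 4)
    match val i, val j with
    | 0%N, 0%N | 1%N, 0%N => 1
    | 0%N, 1%N => (- s - h) / 2
    | 1%N, 1%N => (s - h) / 2
    | 2%N, 2%N | 3%N, 3%N => r
    | _, _ => 0
    end.

Lemma orthonormal_frameP (R : realType) (H F : 'rV[R]_4 -> R) p (r s : R) :
  r * r * F p = s ->
  let P := orthonormal_frame (H p) r s in
  P *m wave_metric H F p *m P^T = s *: minkowski_mx R 4.
Proof.
move=> rs P.
have -> : P *m wave_metric H F p = \matrix_(i < 4, j < 4)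
    match val i, val j with
    | 0%N, 0%N => (H p - s) / 2
    | 1%N, 0%N => (H p + s) / 2
    | 0%N, 1%N | 1%N, 1%N => 1
    | 2%N, 2%N | 3%N, 3%N => r * F p
    | _, _ => 0
    end.
  apply/matrixP; do 2 apply: ord4_ind; rewrite mxE sum4 !mxE /=;
    move: (H p) (F p) => *; by field.
apply/matrixP; do 2 apply: ord4_ind; rewrite mxE sum4 !mxE /=;
  move: (H p) (F p) rs => h f <-; by field.
Qed.

(** * Christoffel symbols of the wave metric *)

Section WaveMetric.
Variables (R : realType) (M : set 'rV[R]_4) (H F : 'rV[R]_4 -> R).
Hypothesis M_open : open M.
Hypotheses (sH : smooth_on M H) (sF : smooth_on M F).
Hypothesis F0 : forall p, M p -> F p != 0.
Hypotheses (Hr : invariant_along ir H).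
Hypotheses (Fx : invariant_along ix F) (Fr : invariant_along ir F).
Implicit Types (p : 'rV[R]_4) (i j k l a b : 'I_4).

Local Notation g := (wave_metric H F).

(** d_r is a Killing field; this yields the vanishing of every r-derivative of
    the Christoffel symbols without computing them. *)
Lemma wave_metric_r_invariant : invariant_along ir g.
Proof. by move=> t p; apply/matrixP => i j; rewrite !mxE Hr Fr. Qed.

Lemma ginv_waveE p : M p -> ginv g p = \matrix_(i < 4, j < 4)
    match val i, val j with
    | 0%N, 1%N | 1%N, 0%N => 1
    | 1%N, 1%N => - H p
    | 2%N, 2%N | 3%N, 3%N => (F p)^-1
    | _, _ => 0
    end.
Proof.
move=> Mp; set E := (RHS).
have gE : g p *m E = 1%:M.
  apply/matrixP; apply: ord4_ind; apply: ord4_ind; rewrite mxE sum4 !mxE /=;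
    by rewrite ?(mulr0, mul0r, mul1r, mulr1, add0r, addr0, mulfV, F0, subrr).
have [gU _] := mulmx1_unit gE.
by rewrite /ginv -[LHS]mulmx1 -gE mulmxA mulVmx// mul1mx.
Qed.

Lemma ginv_row_x (D : 'I_4 -> R) p : M p -> \sum_l ginv g p ix l * D l = D ir.
Proof.
by move=> Mp; rewrite ginv_waveE// sum4 !mxE /= !mul0r add0r !addr0 mul1r.
Qed.

Lemma ginv_row_transverse (D : 'I_4 -> R) a p : M p -> (1 < a)%N ->
  \sum_l ginv g p a l * D l = (F p)^-1 * D a.
Proof.
move=> Mp; rewrite ginv_waveE// sum4; move: a; apply: ord4_ind => // _;
by rewrite !mxE /= !mul0r !add0r ?addr0.
Qed.

Lemma ginv_contraction (D : 'I_4 -> 'I_4 -> R) p : M p ->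
  \sum_i \sum_j ginv g p i j * D i j =
  D ix ir + (D ir ix - H p * D ir ir) + (F p)^-1 * D i3 i3 + (F p)^-1 * D i4 i4.
Proof.
move=> Mp; rewrite sum4 ginv_row_x//.
rewrite (@ginv_row_transverse _ i3)// (@ginv_row_transverse _ i4)//.
congr (_ + _ + _ + _).
by rewrite ginv_waveE// sum4 !mxE /= !mul0r !addr0 mul1r mulNr.
Qed.

Lemma christoffel_r_invariant i j k : invariant_along ir (christoffel g i j k).
Proof.
have dg a b c : invariant_along ir (partial a (fun q => g q b c)).
  by apply: partial_invariant => t p; rewrite wave_metric_r_invariant.
move=> t p; rewrite /christoffel /ginv wave_metric_r_invariant; congr (_ * _).
by apply: eq_bigr => l _; rewrite !dg.
Qed.

Lemma wave_metric_entry i j : (fun q => g q i j) =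
    match val i, val j with
    | 0%N, 0%N => H
    | 0%N, 1%N | 1%N, 0%N => fun=> 1
    | 2%N, 2%N | 3%N, 3%N => F
    | _, _ => fun=> 0
    end.
Proof.
by apply/funext => q; rewrite mxE; move: i j; do 2 apply: ord4_ind.
Qed.

Definition dmetric a i j p : R :=
  match val i, val j with
  | 0%N, 0%N => partial a H p
  | 2%N, 2%N | 3%N, 3%N => partial a F p
  | _, _ => 0
  end.

Lemma partial_metric a i j p : partial a (fun q => g q i j) p = dmetric a i j p.
Proof.
rewrite wave_metric_entry /dmetric.
by move: i j; do 2 apply: ord4_ind; rewrite /= ?partial_cst.
Qed.

Definition lower_christoffel l j k p : R :=
  2^-1 * (dmetric j l k p + dmetric k l j p - dmetric l j k p).

Lemma christoffelE_lower i j k p :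
  christoffel g i j k p = \sum_l ginv g p i l * lower_christoffel l j k p.
Proof.
rewrite /christoffel mulr_sumr; apply: eq_bigr => l _.
by rewrite !partial_metric mulrCA.
Qed.

Lemma christoffel_transverse a j k p : M p -> (1 < a)%N ->
  christoffel g a j k p = (F p)^-1 * lower_christoffel a j k p.
Proof. by move=> Mp a1; rewrite christoffelE_lower ginv_row_transverse. Qed.

Lemma dmetric_r a j p : dmetric a j ir p = 0.
Proof. by move: j; apply: ord4_ind. Qed.

Lemma dmetric_l a j p : dmetric a ir j p = 0.
Proof. by move: j; apply: ord4_ind. Qed.

Lemma dmetric_dr j k p : dmetric ir j k p = 0.
Proof.
rewrite /dmetric; move: j k; do 2 apply: ord4_ind => //=;
  by rewrite partial_along_invariant.
Qed.

(** The only component of the inverse metric along x is g^xr = 1, so this is the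
    symbol with lowered index r: it is made of derivatives of the constant
    components g_rj and of r-derivatives. *)
Lemma christoffel_x j k p : M p -> christoffel g ix j k p = 0.
Proof.
move=> Mp; rewrite christoffelE_lower ginv_row_x// /lower_christoffel.
by rewrite dmetric_dr !dmetric_l addr0 subrr mulr0.
Qed.

Lemma christoffel_rl i k p : christoffel g i ir k p = 0.
Proof.
rewrite christoffelE_lower big1// => l _.
by rewrite /lower_christoffel dmetric_dr dmetric_r dmetric_l addr0 subrr !mulr0.
Qed.

Lemma christoffel_rr i j p : christoffel g i j ir p = 0.
Proof.
rewrite christoffelE_lower big1// => l _.
by rewrite /lower_christoffel dmetric_dr !dmetric_r add0r subrr !mulr0.
Qed.

(** The derivative of (log |F|) / 2; up to sign, the Christoffel symbols of the
    conformally flat transverse surface are these. *)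
Definition half_dlog a p : R := 2^-1 * ((F p)^-1 * partial a F p).
Definition christoffel_xx a p : R := - (2^-1 * ((F p)^-1 * partial a H p)).

(** The Christoffel symbols with transverse upper index: those of the transverse
    surface, and the gradient term from the xx-component of the metric. *)
Definition Gam a j k : 'rV[R]_4 -> R :=
  match val a, val j, val k with
  | _, 0%N, 0%N => christoffel_xx a
  | 2%N, 2%N, 2%N | 3%N, 2%N, 3%N | 3%N, 3%N, 2%N => half_dlog i3
  | 2%N, 3%N, 3%N => fun p => - half_dlog i3 p
  | 3%N, 3%N, 3%N | 2%N, 2%N, 3%N | 2%N, 3%N, 2%N => half_dlog i4
  | 3%N, 2%N, 2%N => fun p => - half_dlog i4 p
  | _, _, _ => fun=> 0
  end.

Lemma christoffel_GamE a j k p : M p -> (1 < a)%N ->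
  christoffel g a j k p = Gam a j k p.
Proof.
move=> Mp a1; rewrite christoffel_transverse// /lower_christoffel.
have d0 : partial ix F p = 0 by exact: partial_along_invariant.
have d1 : partial ir F p = 0 by exact: partial_along_invariant.
have d1H : partial ir H p = 0 by exact: partial_along_invariant.
have := F0 Mp.
rewrite /dmetric /Gam /christoffel_xx /half_dlog; move: a a1 j k.
apply: ord4_ind => // _; do 2 apply: ord4_ind; rewrite /= ?d0 ?d1 ?d1H;
  move: (F p) (partial ix H p) (partial i3 H p) (partial i4 H p)
    (partial i3 F p) (partial i4 F p) => *; by field.
Qed.

(** * Curvature of the wave metric *)

Lemma eq_partial_christoffel i j k l (K : 'rV[R]_4 -> R) p : M p ->
  (forall q, M q -> christoffel g i j k q = K q) ->
  partial l (christoffel g i j k) p = partial l K p.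
Proof. by move=> Mp E; exact: (@eq_partial _ _ M). Qed.

Lemma riemann_up_antisym i j k l p :
  riemann_up g i j k l p = - riemann_up g i j l k p.
Proof.
rewrite /riemann_up opprD opprB -sumrN; congr (_ + _).
by apply: eq_bigr => m _; rewrite opprB.
Qed.

Lemma riemann_up_diag i j k p : riemann_up g i j k k p = 0.
Proof.
by rewrite /riemann_up subrr add0r big1 => // m _; rewrite subrr.
Qed.

Lemma riemann_up_x j k l p : M p -> riemann_up g ix j k l p = 0.
Proof.
move=> Mp; rewrite /riemann_up !(@eq_partial_christoffel ix _ _ _ (fun=> 0))//;
  try by move=> q Mq; exact: christoffel_x.
rewrite !partial_cst subrr add0r big1// => m _.
by rewrite !christoffel_x// !mul0r subrr.
Qed.

Lemma riemann_up_r2 i k l p : M p -> riemann_up g i ir k l p = 0.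
Proof.
move=> Mp; rewrite /riemann_up !(@eq_partial_christoffel i _ ir _ (fun=> 0))//;
  try by move=> q Mq; exact: christoffel_rr.
rewrite !partial_cst subrr add0r big1// => m _.
by rewrite !christoffel_rr !mulr0 subrr.
Qed.

Lemma riemann_up_r3 i j l p : M p -> riemann_up g i j ir l p = 0.
Proof.
move=> Mp; rewrite /riemann_up partial_along_invariant; last first.
  exact: christoffel_r_invariant.
rewrite (@eq_partial_christoffel i _ _ _ (fun=> 0))//;
  last by move=> q Mq; exact: christoffel_rl.
rewrite !partial_cst subrr add0r big1// => m _.
by rewrite !christoffel_rl mul0r mulr0 subrr.
Qed.

Lemma riemann_up_r4 i j k p : M p -> riemann_up g i j k ir p = 0.
Proof. by move=> Mp; rewrite riemann_up_antisym riemann_up_r3// oppr0. Qed.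

(** In the quadratic part the summation index x drops out because no Christoffel
    symbol has upper index x, and r because none has lower index r. *)
Lemma riemann_up_transverse a j k l p : M p -> (1 < a)%N ->
  riemann_up g a j k l p = partial k (Gam a l j) p - partial l (Gam a k j) p
   + ((Gam a k i3 p * Gam i3 l j p - Gam a l i3 p * Gam i3 k j p)
      + (Gam a k i4 p * Gam i4 l j p - Gam a l i4 p * Gam i4 k j p)).
Proof.
move=> Mp a1; rewrite /riemann_up.
rewrite !(fun j k l => @eq_partial_christoffel a j k l (Gam a j k) p Mp
  (fun q Mq => christoffel_GamE j k Mq a1)).
congr (_ + _); rewrite sum4 !christoffel_x// !christoffel_rr !mulr0 !mul0r.
by rewrite !subrr !add0r !christoffel_GamE.
Qed.

Lemma smooth_half_dlog a : smooth_on M (half_dlog a).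
Proof.
apply: (smoothM M_open); first exact: (smooth_cst M_open).
apply: (smoothM M_open); first exact: (smoothV M_open F0 sF).
exact: smooth_partial.
Qed.

Lemma smooth_christoffel_xx a : smooth_on M (christoffel_xx a).
Proof.
apply: (eq_smooth M_open
  (F := fun p => (- 1) * (2^-1 * ((F p)^-1 * partial a H p)))).
  by move=> p _; rewrite mulN1r.
apply: (smoothM M_open); first exact: (smooth_cst M_open).
apply: (smoothM M_open); first exact: (smooth_cst M_open).
apply: (smoothM M_open); first exact: (smoothV M_open F0 sF).
exact: smooth_partial.
Qed.

Lemma half_dlog_x a : invariant_along ix (half_dlog a).
Proof. by move=> t p; rewrite /half_dlog Fx partial_invariant. Qed.

Lemma partial_opp_half_dlog a i p : M p ->
  partial i (fun q => - half_dlog a q) p = - partial i (half_dlog a) p.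
Proof.
move=> Mp; rewrite partialN//; apply: smooth_derivable Mp.
exact: smooth_half_dlog.
Qed.

Lemma partial_half_dlog i a p : M p -> partial i (half_dlog a) p =
  2^-1 * ((F p)^-1 * partial i (partial a F) p
          - partial a F p * ((F p)^-1 * (F p)^-1 * partial i F p)).
Proof.
move=> Mp; have sV := smoothV M_open F0 sF; have sFa := smooth_partial a sF.
have dV := smooth_derivable (i := i) sV Mp.
have dFa := smooth_derivable (i := i) sFa Mp.
have dP := smooth_derivable (i := i) (smoothM M_open sV sFa) Mp.
have dC := smooth_derivable (i := i) (smooth_cst M_open (2^-1)) Mp.
have dF := smooth_derivable (i := i) sF Mp.
rewrite (partialM dC dP) (partialM dV dFa) (partialV (F0 Mp) dF).
by rewrite partial_cst mulr0 addr0 mulN1r mulrN.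
Qed.

(** The symmetry of the second derivatives of F enters here; it makes the
    off-diagonal transverse Ricci components vanish. *)
Lemma half_dlog_closed a b p : M p ->
  partial a (half_dlog b) p = partial b (half_dlog a) p.
Proof.
move=> Mp; rewrite (partial_half_dlog a b Mp) (partial_half_dlog b a Mp).
have E := partialC M_open a b sF Mp; rewrite E {E}.
move: (partial a F p) (partial b F p) (F p)^-1 (partial b _ p) => *; ring.
Qed.

Local Opaque half_dlog christoffel_xx.

(** F times the Gaussian curvature of the transverse surface: for a conformally
    flat metric of factor F this is minus half the Laplacian of log |F|. *)
Definition gauss_density p : R :=
  - partial i3 (half_dlog i3) p - partial i4 (half_dlog i4) p.

Lemma Gam_xr a b : (1 < a)%N -> (1 < b)%N -> Gam a b ix = fun=> 0.
Proof. by move: a; apply: ord4_ind => // _; move: b; apply: ord4_ind. Qed.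

Lemma Gam_xl a b : (1 < a)%N -> (1 < b)%N -> Gam a ix b = fun=> 0.
Proof. by move: a; apply: ord4_ind => // _; move: b; apply: ord4_ind. Qed.

Lemma Gam_x_invariant a b (c : 'I_4) :
  (1 < a)%N -> (1 < b)%N -> (1 < c)%N -> invariant_along ix (Gam a b c).
Proof.
move=> + + + t p; move: a; apply: ord4_ind => // _;
  move: b; apply: ord4_ind => // _; move: c; apply: ord4_ind => // _;
  by rewrite /Gam /= half_dlog_x.
Qed.

Lemma riemann_up_transverse_x a b k p : M p -> (1 < a)%N -> (1 < b)%N ->
  riemann_up g a b ix k p = 0.
Proof.
move=> Mp a1 b1; have [->|k0] := eqVneq k ix; first exact: riemann_up_diag.
have [->|k1] := eqVneq k ir; first exact: riemann_up_r4.
have k2 : (1 < k)%N by move: k k0 k1; apply: ord4_ind.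
rewrite riemann_up_transverse//.
rewrite (partial_along_invariant _ (Gam_x_invariant a1 k2 b1)).
rewrite !Gam_xl// partial_cst.
move: (Gam _ _ _ p) (Gam _ _ _ p) (Gam _ _ _ p) (Gam _ _ _ p) => *.
ring.
Qed.

Lemma riemann_up_x_transverse a b (c : 'I_4) p :
  M p -> (1 < a)%N -> (1 < b)%N -> (1 < c)%N ->
  riemann_up g a ix b c p = 0.
Proof.
move=> Mp a1 b1 c1; rewrite riemann_up_transverse// !Gam_xr// !partial_cst.
move: (Gam _ _ _ p) (Gam _ _ _ p) (Gam _ _ _ p) (Gam _ _ _ p) => *.
ring.
Qed.

Lemma riemann_up_3434 p : M p -> riemann_up g i3 i4 i3 i4 p = gauss_density p.
Proof.
move=> Mp; rewrite riemann_up_transverse// /Gam /= !partial_opp_half_dlog//.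
rewrite /gauss_density.
move: (half_dlog i3 p) (half_dlog i4 p) (partial _ _ p) (partial _ _ p) => *.
ring.
Qed.

Lemma riemann_up_4334 p : M p -> riemann_up g i4 i3 i3 i4 p = - gauss_density p.
Proof.
move=> Mp; rewrite riemann_up_transverse// /Gam /= !partial_opp_half_dlog//.
rewrite /gauss_density.
move: (half_dlog i3 p) (half_dlog i4 p) (partial _ _ p) (partial _ _ p) => *.
ring.
Qed.

Lemma riemann_up_aa34 a p : M p -> (1 < a)%N -> riemann_up g a a i3 i4 p = 0.
Proof.
move=> Mp a1; rewrite riemann_up_transverse//.
move: a a1; apply: ord4_ind => // _;
  rewrite /Gam /= (half_dlog_closed i3 i4)//.
all: move: (half_dlog i3 p) (half_dlog i4 p) (partial _ _ p) => *; ring.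
Qed.

(** This equals minus the flat Laplacian of H divided by 2 F. The unexpanded
    form is visibly a combination of smooth functions. *)
Definition ricci_xx p : R :=
  partial i3 (christoffel_xx i3) p + partial i4 (christoffel_xx i4) p
  + 2 * (half_dlog i3 p * christoffel_xx i3 p
         + half_dlog i4 p * christoffel_xx i4 p).

(** Upper index x kills the curvature, and so does a third index r, so the Ricci
    trace runs over the transverse indices only. *)
Lemma ricci_sum i j p : M p ->
  ricci g i j p = riemann_up g i3 i i3 j p + riemann_up g i4 i i4 j p.
Proof.
by move=> Mp; rewrite /ricci sum4 riemann_up_x// riemann_up_r3// !add0r.
Qed.

Lemma ricciE i j p : M p -> ricci g i j p =
  match val i, val j with
  | 0%N, 0%N => ricci_xx p
  | 2%N, 2%N | 3%N, 3%N => gauss_density p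
  | _, _ => 0
  end.
Proof.
move=> Mp; rewrite ricci_sum//.
move: i j; apply: ord4_ind; apply: ord4_ind => /=.
- rewrite !riemann_up_transverse// /Gam /= !partial_cst /ricci_xx.
  move: (half_dlog _ p) (half_dlog _ p) (christoffel_xx _ p)
    (christoffel_xx _ p) (partial _ _ p) (partial _ _ p) => *; ring.
- by rewrite !riemann_up_r4// addr0.
- by rewrite !riemann_up_x_transverse// addr0.
- by rewrite !riemann_up_x_transverse// addr0.
- by rewrite !riemann_up_r2// addr0.
- by rewrite !riemann_up_r2// addr0.
- by rewrite !riemann_up_r2// addr0.
- by rewrite !riemann_up_r2// addr0.
- by rewrite [X in X + _]riemann_up_antisym [X in _ + X]riemann_up_antisym
    !riemann_up_transverse_x// oppr0 addr0.
- by rewrite !riemann_up_r4// addr0.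
- by rewrite riemann_up_diag add0r riemann_up_antisym riemann_up_4334// opprK.
- by rewrite riemann_up_aa34// add0r riemann_up_diag.
- by rewrite [X in X + _]riemann_up_antisym [X in _ + X]riemann_up_antisym
    !riemann_up_transverse_x// oppr0 addr0.
- by rewrite !riemann_up_r4// addr0.
- by rewrite riemann_up_diag add0r riemann_up_antisym riemann_up_aa34// oppr0.
- by rewrite riemann_up_diag addr0 riemann_up_3434.
Qed.

Lemma scalar_curvatureE p : M p ->
  scalar_curvature g p = 2 * ((F p)^-1 * gauss_density p).
Proof.
move=> Mp; rewrite /scalar_curvature ginv_contraction// !ricciE//=.
move: (F p)^-1 (gauss_density p) => *; ring.
Qed.

Lemma riemann_r1 j k l p : M p -> riemann g ir j k l p = 0.
Proof.
move=> Mp; rewrite /riemann sum4 riemann_up_x// !mxE /=.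
by rewrite mulr0 !mul0r !addr0.
Qed.

Lemma riemann_lower a j k l p : (1 < a)%N ->
  riemann g a j k l p = F p * riemann_up g a j k l p.
Proof.
rewrite /riemann sum4 !mxE; move: a; apply: ord4_ind => // _ /=.
  by rewrite !mul0r !add0r addr0.
by rewrite !mul0r !add0r.
Qed.

Lemma riemann_r2 i k l p : M p -> riemann g i ir k l p = 0.
Proof.
by move=> Mp; rewrite /riemann big1// => m _; rewrite riemann_up_r2// mulr0.
Qed.

Lemma riemann_r3 i j l p : M p -> riemann g i j ir l p = 0.
Proof.
by move=> Mp; rewrite /riemann big1// => m _; rewrite riemann_up_r3// mulr0.
Qed.

Lemma riemann_r4 i j k p : M p -> riemann g i j k ir p = 0.
Proof.
by move=> Mp; rewrite /riemann big1// => m _; rewrite riemann_up_r4// mulr0.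
Qed.

(** Raising a curvature index to x means contracting it with the parallel
    vector d_r. *)
Lemma riemann_mixed_xl i j l p : M p -> riemann_mixed g i j ix l p = 0.
Proof.
move=> Mp; rewrite /riemann_mixed.
under eq_bigr do under eq_bigr do rewrite -mulrA.
under eq_bigr do rewrite -mulr_sumr.
by rewrite ginv_row_x// big1// => b _; rewrite riemann_r3// mulr0.
Qed.

Lemma riemann_mixed_xr i j k p : M p -> riemann_mixed g i j k ix p = 0.
Proof.
move=> Mp; rewrite /riemann_mixed big1// => a _.
under eq_bigr do rewrite -mulrA.
by rewrite -mulr_sumr ginv_row_x// riemann_r4// mulr0.
Qed.

Lemma riemann_mixed_transverse i j a b p : M p -> (1 < a)%N -> (1 < b)%N ->
  riemann_mixed g i j a b p = (F p)^-1 * ((F p)^-1 * riemann g i j a b p).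
Proof.
move=> Mp a1 b1; rewrite /riemann_mixed.
under eq_bigr do under eq_bigr do rewrite -mulrA.
under eq_bigr do rewrite -mulr_sumr.
rewrite ginv_row_transverse//; congr (_ * _); exact: ginv_row_transverse.
Qed.

(** * The curvature condition of pp-waves *)

(** Of the sum only the two orderings of the transverse pair survive, and they
    contribute equally; hence the curvature condition forces the Gaussian
    curvature of the transverse surface to vanish. *)
Lemma pp_sum_34 p : M p ->
  \sum_a \sum_b riemann_mixed g i3 i4 a b p * riemann g a b i3 i4 p
    = 2 * gauss_density p ^+ 2.
Proof.
move=> Mp; rewrite sum_transverse => [|a b]; last first.
  move: a b; apply: ord4_ind => b;
    rewrite ?riemann_mixed_xl ?mul0r ?riemann_r1 ?mulr0//=;
    move: b; apply: ord4_ind => // _;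
    by rewrite ?riemann_mixed_xr ?mul0r ?riemann_r2 ?mulr0.
rewrite !riemann_mixed_transverse// !riemann_lower//.
rewrite !riemann_up_diag (riemann_up_antisym i3 i4 i4).
rewrite riemann_up_3434// riemann_up_4334//.
have := F0 Mp; move: (F p) (gauss_density p) => u v u0.
by field.
Qed.

(** With a flat transverse surface, the curvature needs an index x in its first
    pair. *)
Lemma riemann_transverse_eq0 a b k l p : M p -> gauss_density p = 0 ->
  a != ix -> b != ix -> riemann g a b k l p = 0.
Proof.
move=> Mp K0 a0 b0.
have [->|a1] := eqVneq a ir; first exact: riemann_r1.
have [->|b1] := eqVneq b ir; first exact: riemann_r2.
have tra : (1 < a)%N by move: a a0 a1; apply: ord4_ind.
have trb : (1 < b)%N by move: b b0 b1; apply: ord4_ind.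
rewrite riemann_lower//.
have main : riemann_up g a b i3 i4 p = 0.
  move: a tra {a0 a1}; apply: ord4_ind => // _; move: b trb {b0 b1};
    apply: ord4_ind => // _; rewrite ?riemann_up_aa34//.
    by rewrite riemann_up_3434.
  by rewrite riemann_up_4334// K0 oppr0.
rewrite (_ : riemann_up _ _ _ _ _ _ = 0) ?mulr0//.
move: k l; apply: ord4_ind; apply: ord4_ind;
  rewrite ?riemann_up_diag ?riemann_up_transverse_x ?riemann_up_r3
    ?riemann_up_r4 ?main//;
  by rewrite riemann_up_antisym ?main ?riemann_up_transverse_x ?oppr0.
Qed.

(** Conversely, in every summand an index x among a, b kills the factor where it
    is raised, and the absence of x kills the other factor. *)
Lemma pp_curvatureP : (forall p, M p -> forall i j k l,
    \sum_a \sum_b riemann_mixed g i j a b p * riemann g a b k l p = 0)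
  <-> (forall p, M p -> gauss_density p = 0).
Proof.
split=> [pp p Mp|K0 p Mp i j k l].
  have /eqP := pp p Mp i3 i4 i3 i4; rewrite pp_sum_34// mulf_eq0 expf_eq0 /=.
  by rewrite pnatr_eq0 /= => /eqP.
rewrite big1// => a _; rewrite big1// => b _.
have [->|a0] := eqVneq a ix; first by rewrite riemann_mixed_xl// mul0r.
have [->|b0] := eqVneq b ix; first by rewrite riemann_mixed_xr// mul0r.
by rewrite riemann_transverse_eq0 ?mulr0//; exact: K0.
Qed.

(** * The pure radiation condition *)

(** A tensor rho xi xi with xi null is trace free, whereas the trace of the
    Einstein tensor is minus the scalar curvature in dimension 4; so the
    transverse surface is flat. Conversely, if it is flat then the scalar
    curvature vanishes and the only Ricci component left is the one along
    dx dx, with dx null. *)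
Lemma pure_radiationP (c G : R) : 0 < c -> 0 < G ->
  pure_radiation M g c G 0 <-> (forall p, M p -> gauss_density p = 0).
Proof.
move=> c0 G0; pose C := c ^+ 4 / (8 * pi * G).
have C0 : C != 0.
  rewrite /C gt_eqF// divr_gt0// ?exprn_gt0// !mulr_gt0//; exact: pi_gt0.
have TE i j p : M p -> energy_momentum g c G 0 i j p
    = C * (ricci g i j p - (F p)^-1 * gauss_density p * g p i j).
  move=> Mp; rewrite /energy_momentum scalar_curvatureE// subr0.
  by rewrite [2 * _]mulrC mulfK.
split=> [[rho [xi [_ _ _ null T]]] p Mp|K0].
  have : \sum_i \sum_j ginv g p i j * energy_momentum g c G 0 i j p = 0.
    transitivity (rho p * \sum_i \sum_j ginv g p i j * xi p 0 i * xi p 0 j).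
      rewrite mulr_sumr; apply: eq_bigr => i _; rewrite mulr_sumr.
      apply: eq_bigr => j _; rewrite (T p Mp).
      by move: (ginv _ _ _ _) (rho p) (xi p 0 i) (xi p 0 j) => *; ring.
    by rewrite (null p Mp) mulr0.
  (* the trace of T is - 2 C gauss_density / F *)
  rewrite ginv_contraction// !TE// !ricciE// !mxE /=.
  have := F0 Mp.
  move: (F p) (gauss_density p) (ricci_xx p) (H p) => u v w x u0 E.
  have : C * v = 0.
    have -> : C * v = - 2^-1 * u * (- 2 * C * u^-1 * v) by field.
    rewrite -[RHS](mulr0 (- 2^-1 * u)) -{}E; congr (_ * _); field.
    exact: u0.
  by move/eqP; rewrite mulf_eq0 (negbTE C0) => /eqP.
exists (fun p => C * ricci_xx p), (fun=> delta_mx 0 ix); split.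
- apply: (smoothM M_open); first exact: (smooth_cst M_open).
  apply: (smoothD M_open).
    by apply: (smoothD M_open); apply: smooth_partial;
      exact: smooth_christoffel_xx.
  apply: (smoothM M_open); first exact: (smooth_cst M_open).
  by apply: (smoothD M_open); apply: (smoothM M_open);
    try exact: smooth_half_dlog; exact: smooth_christoffel_xx.
- by move=> i; exact: (smooth_cst M_open).
- move=> p _; apply/eqP => /matrixP /(_ 0 ix); rewrite !mxE eqxx /=.
  by move/eqP; rewrite oner_eq0.
- move=> p Mp; rewrite /null_covector ginv_waveE// sum4 !sum4 !mxE /=.
  by rewrite !(mulr0, mul0r, addr0).
- move=> p Mp i j; rewrite TE// K0// mulr0 mul0r subr0 ricciE//.
  have K := K0 p Mp; move: i j.
  apply: ord4_ind; apply: ord4_ind;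
    by rewrite !mxE /= ?K ?(mulr0, mulr1, mul0r).
Qed.

(** * The parallel null vector field and the signature *)

Lemma lorentzian_wave (s : R) : s = 1 \/ s = -1 ->
  (forall p, M p -> 0 < s * F p) -> lorentzian M g.
Proof.
move=> s1 sF0; have ss : s * s = 1 by case: s1 => ->; ring.
split.
- move=> i j; rewrite wave_metric_entry; move: i j.
  by do 2 apply: ord4_ind => //=; exact: (smooth_cst M_open).
- by move=> p _; apply/matrixP; do 2 apply: ord4_ind; rewrite !mxE.
exists s => // p Mp.
pose r := (Num.sqrt (s * F p))^-1.
have rF : r * r * F p = s.
  rewrite /r -invfM -expr2 sqr_sqrtr ?ltW ?sF0//.
  rewrite invfM mulfVK ?F0//; case: s1 => ->; rewrite ?invrN invr1//.
pose P := orthonormal_frame (H p) r s.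
have PgP : P *m g p *m P^T = s *: minkowski_mx R 4 by exact: orthonormal_frameP.
exists P => //.
have : P *m (g p *m P^T *m (s *: minkowski_mx R 4)) = 1%:M.
  rewrite !mulmxA PgP -scalemxAl -scalemxAr scalerA ss scale1r.
  apply/matrixP; do 2 apply: ord4_ind; rewrite mxE sum4 !mxE /=; ring.
by case/mulmx1_unit.
Qed.

(** The coordinate field d_r is null and, as no Christoffel symbol has a lower
    index r, parallel. *)
Lemma brinkmann_wave_metric : lorentzian M g -> brinkmann_wave M g.
Proof.
move=> Lg; split=> //; exists (fun=> delta_mx 0 ir); split.
- by move=> i; exact: (smooth_cst M_open).
- move=> p _; apply/eqP => /matrixP /(_ 0 ir); rewrite !mxE eqxx /=.
  by move/eqP; rewrite oner_eq0.
- move=> p Mp; rewrite /null_vector sum4 !sum4 !mxE /=.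
  by rewrite !(mulr0, mul0r, addr0).
- move=> p Mp i j; rewrite /covariant_deriv partial_cst add0r sum4.
  by rewrite christoffel_rr !mxE /= !(mulr0, mul0r, addr0).
Qed.

End WaveMetric.

(** The image of a connected set is an interval, which cannot meet both sides
    of 0 while avoiding 0. For a generalized pp-wave the sign of the transverse
    coefficient decides which of the two signature conventions holds on all
    of M. *)
Lemma constant_sign (R : realType) n (M : set 'rV[R]_n) (F : 'rV[R]_n -> R) :
  connected M -> (forall p, M p -> {for p, continuous F}) ->
  (forall p, M p -> F p != 0) ->
  exists2 s : R, s = 1 \/ s = -1 & forall p, M p -> 0 < s * F p.
Proof.
move=> M_conn cF F0.
have im_itv : is_interval (F @` M).
  apply/connected_intervalP; apply: connected_continuous_connected => //.
  apply/subspace_continuousP => p Mp; apply: cvg_within_filter; exact: cF.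
have [[p [Mp Fp]]|noP] := pselect (exists p, M p /\ 0 < F p).
  exists 1; first by left.
  move=> q Mq; rewrite mul1r lt_neqAle eq_sym F0//= leNgt.
  apply/negP => /ltW Fq.
  have [|z Mz Fz] := im_itv _ _ (imageP F Mq) (imageP F Mp) 0.
    by rewrite Fq ltW.
  by have := F0 z Mz; rewrite Fz eqxx.
exists (-1); first by right.
move=> q Mq; rewrite mulN1r oppr_gt0 lt_neqAle F0//= leNgt; apply/negP => Fq.
by apply: noP; exists q.
Qed.

(** * The equivalence *)

Theorem theorem5p1 (R : realType) (c G Lambda : R)
    (hc : 0 < c) (hG : 0 < G)
    (M : set 'rV[R]_4) (M_open : open M) (M_conn : connected M)
    (h : R -> R -> R -> R) (f : R -> R -> R)
    (h_smooth : smooth_on M (h_on_R4 h))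
    (f_smooth : smooth_on M (f_on_R4 f))
    (h_neq0 : forall p, M p -> h_on_R4 h p <> 0)
    (f_neq0 : forall p, M p -> f_on_R4 f p <> 0)
    (hLambda : Lambda = 0) :
  pure_radiation M (gen_pp_metric h f) c G Lambda <->
  pp_wave M (gen_pp_metric h f).
Proof.
rewrite {}hLambda.
pose H p : R := - 2 * h_on_R4 h p; pose F p : R := - 2^-1 * f_on_R4 f p.
rewrite -[gen_pp_metric h f]/(wave_metric H F).
have sH : smooth_on M H by apply: smoothM => //; exact: smooth_cst.
have sF : smooth_on M F by apply: smoothM => //; exact: smooth_cst.
have F0 p : M p -> F p != 0.
  move=> Mp; rewrite mulf_neq0 ?oppr_eq0 ?invr_eq0 ?pnatr_eq0//.
  exact/eqP/f_neq0.
have coord i j (t : R) (q : 'rV[R]_4) : i != j ->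
    (t *: delta_mx 0 i + q) 0 j = q 0 j.
  by move=> ij; rewrite !mxE eqxx /= eq_sym (negbTE ij) mulr0 add0r.
have Hr : invariant_along ir H.
  by move=> t q; rewrite /H /h_on_R4 !coord.
have Fx : invariant_along ix F.
  by move=> t q; rewrite /F /f_on_R4 !coord.
have Fr : invariant_along ir F.
  by move=> t q; rewrite /F /f_on_R4 !coord.
have [s s1 sF0] : exists2 s : R, s = 1 \/ s = -1 & forall p, M p -> 0 < s * F p.
  by apply: constant_sign => // p Mp; exact: smooth_continuous sF Mp.
have wave : brinkmann_wave M (wave_metric H F).
  apply: (brinkmann_wave_metric M_open Hr Fr).
  exact: (lorentzian_wave M_open sH sF F0 s1 sF0).
have PR := pure_radiationP M_open sH sF F0 Hr Fx Fr hc hG.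
have PP := pp_curvatureP M_open sF F0 Hr Fx Fr.
split=> [/PR/PP|[_ /PP/PR]]; first by split.
by [].
Qed.
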